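(* Let $K$ be a field and let $I\subset K[x,y]$ be a concave monomial ideal of height $2$. Then the following conditions are equivalent: (a) $I$ has no inner corner points; (b) $I^k$ is concave for all integers $k\ge1$; (c) there exists an integer $k\ge2$ such that $I^k$ is concave. In particular, $I^k$ is not concave for all $k\ge2$ (that is, no power $I^k$ with $k\ge 2$ is concave) if $I$ has an inner corner point.
   Context: For a monomial ideal $I\subset K[x,y]$ of height $2$, $G(I)=\{u_1,\ldots,u_m\}$ is its unique minimal set of monomial generators, labeled so that $u_1>\cdots>u_m$ lexicographically (with $x>y$). Writing $u_i=x^{a_i}y^{b_i}$, one has $a_1>\cdots>a_m=0$ and $0=b_1<\cdots<b_m$. The exponent vector of $u_i$ is $\mathbf c_i=(a_i,b_i)$. For integer vectors, $\mathbf a\le\mathbf b$ means componentwise inequality, and $\mathbf a<\mathbf b$ means $\mathbf a\le\mathbf b$ and $\mathbf a\ne\mathbf b$. The ideal $I$ is concave if $2\mathbf c_i\ge\mathbf c_{i-1}+\mathbf c_{i+1}$ for $i=2,\ldots,m-1$. An inner corner point of a concave ideal $I$ is a vector $\mathbf c_i$ with $2\le i\le m-1$ and $2\mathbf c_i>\mathbf c_{i-1}+\mathbf c_{i+1}$. *)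

(* Defs.v *)
From HB Require Import structures.
From mathcomp Require Import all_boot all_order all_algebra.
From mathcomp Require Import boolp classical_sets.
From mathcomp Require Import mpoly.

Set Implicit Arguments.
Unset Strict Implicit.
Unset Printing Implicit Defensive.

Import GRing.Theory.

Local Open Scope classical_set_scope.
Local Open Scope ring_scope.

Section Ideals.
Variable R : comNzRingType.
Implicit Types (I J P S : set R) (n k : nat).

(* MathComp's idealr is not used: it is boolean-valued and excludes the unit
   ideal. *)
Definition is_ideal I : Prop :=
  [/\ I 0, forall u v, I u -> I v -> I (u + v) & forall a u, I u -> I (a * u)].

Definition ideal_gen S : set R :=
  [set f | forall J, is_ideal J -> S `<=` J -> J f].

Definition ideal_mul I J : set R :=
  ideal_gen [set f | exists u v, [/\ I u, J v & f = u * v]].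

Fixpoint ideal_pow I k : set R :=
  if k is k'.+1 then ideal_mul I (ideal_pow I k') else setT.

Definition is_prime_ideal P : Prop :=
  [/\ is_ideal P, ~ P 1 & forall u v, P (u * v) -> P u \/ P v].

Definition prime_height_ge P n : Prop :=
  exists C : nat -> set R,
    [/\ forall i, (i <= n)%N -> is_prime_ideal (C i),
        forall i, (i < n)%N -> C i `<` C i.+1 & C n = P].

(* The height of I is the least height of a prime containing I; the unit ideal
   has infinite height. *)
Definition height_ge I n : Prop :=
  forall P, is_prime_ideal P -> I `<=` P -> prime_height_ge P n.

Definition has_height I n : Prop := height_ge I n /\ ~ height_ge I n.+1.

End Ideals.

Section MonomialIdeals.
Variable K : fieldType.
Implicit Types (I : set {mpoly K[2]}) (c : 'X_{1..2}) (s t : seq 'X_{1..2}).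

Definition monomials (M : set 'X_{1..2}) : set {mpoly K[2]} :=
  [set 'X_[c] | c in M].

Definition is_monomial_ideal I : Prop :=
  exists M : set 'X_{1..2}, I = ideal_gen (monomials M).

(* Pure lexicographic order with x > y, where x and y are the variables of
   index 0 and 1; the order carried by 'X_{1..2} compares degrees first. *)
Definition lex_gt c1 c2 : bool :=
  (c2 ord0 < c1 ord0)%N
  || (c1 ord0 == c2 ord0) && (c2 ord_max < c1 ord_max)%N.

(* s lists the exponent vectors of G(I) in lexicographically decreasing
   order. *)
Definition is_min_gens I s : Prop :=
  [/\ sorted lex_gt s,
      I = ideal_gen (monomials [set` s])
    & forall t, {subset t <= s} -> I = ideal_gen (monomials [set` t]) ->
        {subset s <= t}].

(* Indices start at 0, so c_{i-1}, c_i, c_{i+1} become the entries i, i+1, i+2.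
   lem and ltm are the componentwise order and its strict part. *)
Definition concave I : Prop :=
  exists s, is_min_gens I s /\
    forall i, (i.+2 < size s)%N ->
      (lem (nth 0 s i + nth 0 s i.+2) (nth 0 s i.+1 *+ 2))%MM.

Definition inner_corner_point I c : Prop :=
  exists s i,
    [/\ is_min_gens I s, (i.+2 < size s)%N, c = nth 0%MM s i.+1
      & (ltm (nth 0 s i + nth 0 s i.+2) (nth 0 s i.+1 *+ 2))%MM].

End MonomialIdeals.

(* Main.v *)
Require Import Defs.
From mathcomp Require Import all_boot all_order all_algebra.
From mathcomp Require Import boolp classical_sets.
From mathcomp Require Import mpoly.
From mathcomp Require Import zify.

Set Implicit Arguments.
Unset Strict Implicit.
Unset Printing Implicit Defensive.

Import GRing.Theory.

Local Open Scope classical_set_scope.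
Local Open Scope ring_scope.

(** List the exponent vectors of the minimal generators of [I] as
    [c_0, ..., c_n].  Since [I] has height 2, [c_0 = (A, 0)] and
    [c_n = (0, B)]: otherwise [I] would lie in the ideal of a single variable,
    a prime of height at most 1 ([height2_ends]).

    Without inner corner points both coordinates of [c_i] are arithmetic
    progressions, so [c_i = ((n - i) p, i q)].  Such equally spaced sets add up
    to equally spaced sets with the same [p] and [q], so every power of [I] is
    again of this form, hence concave ([spaced_points_concave_pow]).

    Suppose now that there is an inner corner point.  The weight
    [w(x, y) = x B + y A] equals [A B] at [c_0] and at [c_n], and
    [i |-> w(c_i)] is a concave sequence that is not constant, so
    [w(c_i) > A B] for [0 < i < n] ([inner_corner_line]).  Consequently
    [w >= k A B] on the exponents of [I^k], and equality holds only at the sums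
    of [k] vectors taken from [c_0] and [c_n].  Those sums are minimal
    generators of [I^k].  If [I^k] is concave, the weights of its minimal
    generators form a concave sequence that attains its minimum [k A B] at
    both ends and, for [k >= 2], also at the interior term
    [(k - 1) c_0 + c_n]; such a sequence is constant
    ([concave_seq_interior_min]).  Then every minimal generator of [I^k] is a
    sum of copies of [c_0] and [c_n].  None of these is below
    [(k - 1) c_0 + c_1], whose first coordinate is less than [k A] and whose
    second coordinate is less than [B]; but this vector is an exponent of
    [I^k], a contradiction ([inner_corner_pow_not_concave]). *)

(** * Ideals generated by a set *)

Section IdealLemmas.
Variable R : comNzRingType.
Implicit Types (I J S : set R).

Lemma sub_ideal_gen S : S `<=` ideal_gen S.
Proof. by move=> f Sf J _; apply. Qed.

Lemma ideal_gen_sub S J : is_ideal J -> S `<=` J -> ideal_gen S `<=` J.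
Proof. by move=> idJ SJ f; apply. Qed.

Lemma ideal_gen_is_ideal S : is_ideal (ideal_gen S).
Proof.
split=> [J []//|u v Su Sv J idJ SJ|a u Su J idJ SJ].
  by case: (idJ) => _ D _; apply: D; [apply: Su | apply: Sv].
by case: (idJ) => _ _ M; apply: M; apply: Su.
Qed.

Lemma ideal_sum I (T : eqType) (r : seq T) (F : T -> R) :
  is_ideal I -> (forall i, i \in r -> I (F i)) -> I (\sum_(i <- r) F i).
Proof.
case=> I0 ID _ IF; rewrite big_seq.
by apply: (big_ind I) => // i; apply: IF.
Qed.

End IdealLemmas.

(** * The prime ideal of a variable *)

Section VariableIdeal.
Variables (n : nat) (R : idomainType) (i : 'I_n).
Implicit Types (f g : {mpoly R[n]}).

(** The ideal generated by ['X_i], described through supports so that it can be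
    compared with monomial ideals directly. *)
Definition variable_ideal : set {mpoly R[n]} :=
  [set f | forall c, c \in msupp f -> (0 < c i)%N].

Definition kill_variable : n.-tuple {mpoly R[n]} :=
  [tuple if j == i then 0 else 'X_j | j < n].

Lemma kill_variableX (c : 'X_{1..n}) :
  'X_[c] \mPo kill_variable = (if (0 < c i)%N then 0 else 'X_[c]).
Proof.
rewrite comp_mpolyX; case: ifPn => [ci|].
  by rewrite (bigD1 i) //= tnth_mktuple eqxx expr0n gtn_eqF // mul0r.
rewrite -leqNgt leqn0 => /eqP ci; rewrite [RHS]mpolyXE_id.
apply: eq_bigr => j _; rewrite tnth_mktuple; case: eqP => // ->.
by rewrite ci !expr0.
Qed.

Lemma kill_variable_coef f (c : 'X_{1..n}) :
  c i = 0%N -> (f \mPo kill_variable)@_c = f@_c.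
Proof.
move=> ci; rewrite comp_mpolyEX [in RHS](mpolyE f) !raddf_sum /=.
apply: eq_bigr => d _; rewrite !mcoeffZ kill_variableX.
case: ifPn => // di; rewrite mcoeff0 mcoeffX.
by case: eqP => // dc; rewrite dc ci in di.
Qed.

(** The ideal is the kernel of the substitution [x_i := 0], because this
    substitution leaves the coefficients of the monomials free of [x_i]
    untouched.  Primality follows, the target being a domain. *)
Lemma variable_idealE f : variable_ideal f <-> f \mPo kill_variable = 0.
Proof.
split=> [Vf|f0 c].
  rewrite comp_mpolyEX big_seq big1 // => c fc.
  by rewrite kill_variableX Vf // scaler0.
rewrite mcoeff_msupp; case: (posnP (c i)) => // ci.
by rewrite -kill_variable_coef // f0 mcoeff0 eqxx.
Qed.

Lemma variable_ideal_prime : is_prime_ideal variable_ideal.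
Proof.
split.
- split=> [|f g|f g].
  + by move=> c; rewrite msupp0.
  + by rewrite !variable_idealE comp_mpolyD => -> ->; rewrite addr0.
  + by rewrite !variable_idealE rmorphM /= => ->; rewrite mulr0.
- by rewrite variable_idealE rmorph1; apply/eqP; rewrite oner_eq0.
- move=> f g; rewrite !variable_idealE rmorphM => /eqP.
  by rewrite mulf_eq0 => /orP[] /eqP; [left|right].
Qed.

Lemma variable_ideal_factor f : variable_ideal f ->
  exists g, f = 'X_i * g.
Proof.
move=> Vf; exists (\sum_(c <- msupp f) f@_c *: 'X_[c - U_(i)]).
rewrite [LHS]mpolyE mulr_sumr [RHS]big_seq [LHS]big_seq; apply: eq_bigr => c fc.
rewrite -scalerAr -mpolyXD addmC submK //.
by rewrite lep1mP -lt0n Vf.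
Qed.

Lemma msize_mulX g : g != 0 -> (msize g < msize ('X_i * g))%N.
Proof.
have X0 : 'X_i != 0 :> {mpoly R[n]} by rewrite -msupp_eq0 msuppX.
by move=> g0; rewrite msizeM // msizeX mdeg1 add2n.
Qed.

(** If [f = x_i g] lies in a prime ideal [P] that does not contain [x_i], then
    [g] lies in [P] too, hence is again divisible by [x_i]; since the degree
    drops at each step, this descent stops only at [0]. *)
Lemma prime_below_variable_ideal (P : set {mpoly R[n]}) :
  is_prime_ideal P -> P `<` variable_ideal -> forall f, P f -> f = 0.
Proof.
case=> -[_ _ PM] _ Pp [PV /nonsubset[h [Vh nPh]]].
have nPX : ~ P 'X_i.
  by have [g hE] := variable_ideal_factor Vh; move: nPh; rewrite hE mulrC => nP PX; apply/nP/PM.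
move=> f; have [m] := ubnP (msize f); elim: m f => // m IHm f lefm Pf.
have [g fE] := variable_ideal_factor (PV _ Pf).
have [g0|gN0] := eqVneq g 0; first by rewrite fE g0 mulr0.
have : P g by case: (Pp 'X_i g); rewrite -?fE.
move=> /IHm g0; case/eqP: (gN0); apply: g0.
apply: (@leq_trans (msize f)); last by rewrite -ltnS.
by rewrite fE msize_mulX.
Qed.

Lemma variable_ideal_height : ~ prime_height_ge variable_ideal 2.
Proof.
case=> C [Cprime Clt C2].
have C1V : C 1%N `<` variable_ideal by rewrite -C2; apply: Clt.
have C1_0 := prime_below_variable_ideal (Cprime 1%N isT) C1V.
have [_ /nonsubset[f [C1f]]] := Clt 0%N isT.
by rewrite (C1_0 f C1f); case: (Cprime 0%N isT) => -[C0 _ _] _ _; apply.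
Qed.

End VariableIdeal.

(** * Monomial ideals and their exponents *)

Section MonomialIdealExponents.
Variable K : fieldType.
Implicit Types (I : set {mpoly K[2]}) (M N : set 'X_{1..2}).
Implicit Types (c d : 'X_{1..2}) (s t : seq 'X_{1..2}).

Definition upper M : set 'X_{1..2} := [set c | exists2 d, M d & (d <= c)%MM].

Definition sumset M N : set 'X_{1..2} :=
  [set c | exists d e, [/\ M d, N e & c = (d + e)%MM]].

Definition nsumset M k : set 'X_{1..2} := iter k (sumset M) [set 0%MM].

Lemma upper_lem M c d : upper M c -> (c <= d)%MM -> upper M d.
Proof. by case=> e Me ec cd; exists e => //; apply: lepm_trans ec cd. Qed.

(** A monomial ideal is spanned by the monomials it contains, so it is determined
    by an up-closed set of exponents; this turns questions about monomial ideals
    into questions about vectors of natural numbers. *)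
Lemma ideal_gen_monomialsE M :
  ideal_gen (@monomials K M) = [set f | forall c, c \in msupp f -> upper M c].
Proof.
apply/seteqP; split.
  apply: ideal_gen_sub.
    split=> [c|f g Mf Mg c /msuppD_le|a f Mf c /msuppM_le].
    + by rewrite msupp0.
    + by rewrite mem_cat => /orP[/Mf|/Mg].
    + case/allpairsP=> -[d e] /= [_ /Mf Me ->]; exact: upper_lem Me (lem_addl _ _).
  move=> _ [d Md <-] c /mem_msuppXP <-; exists d => //; exact: lepm_refl.
move=> f Mf; rewrite (mpolyE f).
apply: ideal_sum; first exact: ideal_gen_is_ideal.
move=> c /Mf[d Md dc]; rewrite -(submK dc) mpolyXD -mul_mpolyC mulrA.
have [_ _] := ideal_gen_is_ideal (@monomials K M); apply.
by apply: sub_ideal_gen; exists d.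
Qed.

Lemma ideal_gen_monomialsX M c : ideal_gen (@monomials K M) 'X_[c] <-> upper M c.
Proof.
rewrite ideal_gen_monomialsE; split=> [|Mc d]; last by move/mem_msuppXP=> <-.
by apply; rewrite msuppX mem_head.
Qed.

Lemma eq_ideal_gen_monomials M N :
  (ideal_gen (@monomials K M) = ideal_gen (@monomials K N)) <-> upper M = upper N.
Proof.
split=> [MN|MN]; last by rewrite !ideal_gen_monomialsE MN.
apply/seteqP; split=> c; rewrite -!ideal_gen_monomialsX; last by rewrite MN.
by rewrite -MN.
Qed.

Lemma ideal_mul_monomials M N :
  ideal_mul (ideal_gen (@monomials K M)) (ideal_gen (@monomials K N)) =
  ideal_gen (@monomials K (sumset M N)).
Proof.
apply/seteqP; split; apply: ideal_gen_sub => //; try exact: ideal_gen_is_ideal.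
  move=> _ [f [g [Mf Ng ->]]]; rewrite ideal_gen_monomialsE => c /msuppM_le.
  case/allpairsP=> -[d e] /= [fd ge ->].
  move: Mf Ng; rewrite !ideal_gen_monomialsE => /(_ _ fd)[d' Md' dd] /(_ _ ge)[e' Ne' ee].
  exists (d' + e')%MM; first by exists d', e'.
  by apply/mnm_lepP => i; rewrite !mnmDE leq_add // (mnm_lepP _ _).
move=> _ [_ [d [e [Md Ne ->]]] <-]; apply: sub_ideal_gen.
exists 'X_[d], 'X_[e]; split; last by rewrite mpolyXD.
  by apply: sub_ideal_gen; exists d.
by apply: sub_ideal_gen; exists e.
Qed.

Lemma ideal_pow_monomials M k :
  ideal_pow (ideal_gen (@monomials K M)) k =
  ideal_gen (@monomials K (nsumset M k)).
Proof.
elim: k => [|k IHk] /=; last by rewrite IHk ideal_mul_monomials.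
rewrite ideal_gen_monomialsE; apply/seteqP; split=> // f _ c _.
by exists 0%MM => //; apply/mnm_lepP => i; rewrite mnm0E.
Qed.

Lemma nsumset_mul M c k : M c -> nsumset M k (c *+ k)%MM.
Proof.
by move=> Mc; elim: k => [|k IHk] //; rewrite mulmS; exists c, (c *+ k)%MM.
Qed.

(** If no exponent in [M] vanishes at [i], the ideal lies in the prime generated
    by ['X_i], whose height is at most 1. *)
Lemma height2_pure_power M (i : 'I_2) :
  height_ge (ideal_gen (@monomials K M)) 2 -> exists2 c, M c & c i = 0%N.
Proof.
move=> ht; apply: contrapT => noM.
apply: (@variable_ideal_height 2 K i); apply: ht; first exact: variable_ideal_prime.
rewrite ideal_gen_monomialsE => f Mf c /Mf [d Md dc].
apply: leq_trans (mnm_lepP dc i); rewrite lt0n; apply/eqP => di.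
by apply: noM; exists d.
Qed.

(** * Minimal generating sets *)

Lemma lex_gt_trans : transitive lex_gt.
Proof. by rewrite /lex_gt => d c e; lia. Qed.

Lemma lex_gt_irr : irreflexive lex_gt.
Proof. by rewrite /lex_gt => c; lia. Qed.

Definition antichain s : Prop :=
  forall c d, c \in s -> d \in s -> (c <= d)%MM -> c = d.

Lemma ord2P (i : 'I_2) : i = ord0 \/ i = ord_max.
Proof. by case: i => [[|[|//]] ?]; [left|right]; apply: val_inj. Qed.

Lemma mnm2P c d : c ord0 = d ord0 -> c ord_max = d ord_max -> c = d.
Proof.
move=> c0 c1; apply/mnmP => i.
by case: (ord2P i) => ->.
Qed.

Lemma lem2P c d :
  reflect (c ord0 <= d ord0 /\ c ord_max <= d ord_max)%N (c <= d)%MM.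
Proof.
apply: (iffP mnm_lepP) => [le_cd|[le0 le1] i]; first by split.
by case: (ord2P i) => ->.
Qed.

(** If [c] lies strictly below [d], the monomial of [d] is redundant. *)
Lemma min_gens_antichain I s : is_min_gens I s -> antichain s.
Proof.
case=> _ Is smin c d sc sd cd; apply/eqP/negPn/negP => cNd.
have /(_ d sd) : {subset s <= [seq e <- s | e != d]}; last first.
  by rewrite mem_filter eqxx.
apply: smin => [e|]; first by rewrite mem_filter => /andP[].
rewrite Is; apply/eq_ideal_gen_monomials/seteqP; split=> e [f /= sf fe].
  have [fd|fNd] := eqVneq f d.
    exists c; last by apply: lepm_trans cd _; rewrite -fd.
    by rewrite /= mem_filter cNd.
  by exists f; rewrite //= mem_filter fNd.
by exists f => //=; move: sf; rewrite mem_filter => /andP[].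
Qed.

Lemma antichain_min_gens s : sorted lex_gt s -> antichain s ->
  is_min_gens (ideal_gen (@monomials K [set` s])) s.
Proof.
move=> s_sorted s_anti; split=> // t ts /eq_ideal_gen_monomials ut c sc.
have [d /= td dc] : upper [set` t] c.
  by rewrite -ut; exists c => //; exact: lepm_refl.
by rewrite -(s_anti d c) // ts.
Qed.

Lemma min_gens_sub I s t : is_min_gens I s -> is_min_gens I t -> {subset s <= t}.
Proof.
move=> Is It c sc; have s_anti := min_gens_antichain Is.
case: Is It => _ Is _ [_ It _].
have ust : upper [set` s] = upper [set` t].
  by apply/eq_ideal_gen_monomials; rewrite -Is.
have [d /= td dc] : upper [set` t] c.
  by rewrite -ust; exists c => //; exact: lepm_refl.
have [e /= se ed] : upper [set` s] d.
  by rewrite ust; exists d => //; exact: lepm_refl.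
have ec : e = c by apply: s_anti => //; apply: lepm_trans ed dc.
suff -> : c = d by [].
by move: ed; rewrite ec => /lem2P[? ?]; case/lem2P: dc => ? ?; apply: mnm2P; lia.
Qed.

(** Two antichains with the same up-closure have the same elements, and the
    lexicographic order leaves only one way to list them. *)
Lemma min_gens_unique I s t : is_min_gens I s -> is_min_gens I t -> s = t.
Proof.
move=> Is It; have [[ss _ _] [st _ _]] := (Is, It).
apply: (irr_sorted_eq lex_gt_trans lex_gt_irr) => // c.
by apply/idP/idP; [apply: (min_gens_sub Is It)|apply: (min_gens_sub It Is)].
Qed.

(** Lexicographic decrease alone allows [y] to decrease as well; incomparability
    forces it to increase, and [x] to decrease strictly. *)
Lemma min_gens_staircase I s i j : is_min_gens I s -> (i < j < size s)%N ->
  (nth 0%MM s j ord0 < nth 0%MM s i ord0)%N /\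
  (nth 0%MM s i ord_max < nth 0%MM s j ord_max)%N.
Proof.
move=> Is /andP[ij js]; have s_anti := min_gens_antichain Is.
have si : (i < size s)%N by exact: ltn_trans js.
have gt_ij : lex_gt (nth 0%MM s i) (nth 0%MM s j).
  by case: Is => ss _ _; apply: (sorted_ltn_nth lex_gt_trans).
have nle_ji : ~~ (nth 0 s j <= nth 0 s i)%MM.
  apply/negP => /(s_anti _ _ (mem_nth _ js) (mem_nth _ si)) ji.
  by move: gt_ij; rewrite ji lex_gt_irr.
move: gt_ij nle_ji; rewrite /lex_gt => gt_ij /lem2P nle_ji; lia.
Qed.

Lemma min_gens_first I s c : is_min_gens I s -> c \in s -> c ord_max = 0%N ->
  c = nth 0%MM s 0.
Proof.
move=> Is /(nthP 0%MM)[[|j] js <- c0] //.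
by have [//|_] := @min_gens_staircase I s 0 j.+1 Is; rewrite c0.
Qed.

Lemma min_gens_last I s c : is_min_gens I s -> c \in s -> c ord0 = 0%N ->
  c = nth 0%MM s (size s).-1.
Proof.
move=> Is /(nthP 0%MM)[j js <- c0].
have [->//|jN] := eqVneq j (size s).-1.
by have [|+ _] := @min_gens_staircase I s j (size s).-1 Is; [move: jN js; set N := size s; lia|rewrite c0].
Qed.

Lemma height2_ends I s : is_min_gens I s -> height_ge I 2 ->
  [/\ (0 < size s)%N, nth 0%MM s 0 ord_max = 0%N
    & nth 0%MM s (size s).-1 ord0 = 0%N].
Proof.
move=> Is htI; have [_ IE _] := Is; rewrite IE in htI.
have [c /= sc c0] := height2_pure_power ord0 htI.
have [d /= sd d0] := height2_pure_power ord_max htI.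
split; first by case: (s) sc.
  by rewrite -(min_gens_first Is sd d0).
by rewrite -(min_gens_last Is sc c0).
Qed.

End MonomialIdealExponents.

(** * Concave sequences *)

Section ConcaveSequences.
Implicit Types (g : nat -> nat) (n : nat).

Definition concave_seq n g : Prop :=
  forall i, (i.+2 <= n)%N -> (g i + g i.+2 <= (g i.+1).*2)%N.

(** At an interior term that is minimal, concavity bounds the sum of the two
    neighbours by twice the minimum, so both neighbours are minimal too, and
    minimality spreads in both directions. *)
Lemma concave_seq_interior_min n g j : concave_seq n g -> (0 < j < n)%N ->
  (forall i, (i <= n)%N -> (g j <= g i)%N) ->
  forall i, (i <= n)%N -> g i = g j.
Proof.
move=> gconc jn gmin i i_n.
have up d : (j + d <= n)%N -> g (j + d)%N = g j.
  elim: d => [|d IHd] jd; first by rewrite addn0.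
  have := gconc (j + d).-1; have := gmin (j + d).-1; have := gmin (j + d.+1)%N.
  have -> : ((j + d).-1.+2 = j + d.+1)%N by lia.
  have -> : ((j + d).-1.+1 = j + d)%N by lia.
  by rewrite IHd; lia.
have down d : (d <= j)%N -> g (j - d)%N = g j.
  elim: d => [|d IHd] jd; first by rewrite subn0.
  have := gconc (j - d.+1)%N; have := gmin (j - d.+1)%N; have := gmin (j - d).+1.
  have -> : ((j - d.+1).+2 = (j - d).+1)%N by lia.
  have -> : ((j - d.+1).+1 = j - d)%N by lia.
  by rewrite IHd; lia.
have [ij|ji] := leqP i j; first by rewrite -(subKn ij) down ?leq_subr.
by rewrite -(subnKC (ltnW ji)) up //; lia.
Qed.

(** A minimum attained in the interior makes the sequence constant, so the minimum
    is always attained at an end. *)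
Lemma concave_seq_ge_ends n g : concave_seq n g -> g 0%N = g n ->
  forall i, (i <= n)%N -> (g 0%N <= g i)%N.
Proof.
move=> gconc g0n i i_n.
pose j := [arg min_(j < (ord0 : 'I_n.+1)) g j].
have gmin m : (m <= n)%N -> (g j <= g m)%N.
  rewrite /j -ltnS => mn.
  by case: arg_minnP => // l _ /(_ (Ordinal mn)); apply.
apply: leq_trans (gmin _ i_n).
have [jn|jn] := boolP (0 < j < n)%N.
  by rewrite (concave_seq_interior_min gconc jn gmin).
have [->//|->] : j = 0%N :> nat \/ j = n :> nat by have := ltn_ord j; lia.
by rewrite g0n.
Qed.

Lemma concave_seq_zero_second_difference n g :
  (forall i, (i.+2 <= n)%N -> g i + g i.+2 = (g i.+1).*2)%N -> g 0%N = 0%N ->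
  forall i, (i <= n)%N -> g i = (i * g 1)%N.
Proof.
move=> garith g0 i.
(* The recurrence has order two, so two consecutive terms are carried. *)
suff: ((i <= n)%N -> g i = (i * g 1)%N) /\ ((i.+1 <= n)%N -> g i.+1 = (i.+1 * g 1)%N).
  by case.
elim: i => [|i [IH1 IH2]]; first by rewrite g0 !mul1n.
split=> // i_n; have := garith i i_n; rewrite IH1 ?IH2 //; lia.
Qed.

End ConcaveSequences.

(** * Equally spaced exponents *)

Section EquallySpaced.
Variable K : fieldType.
Implicit Types (I : set {mpoly K[2]}) (s : seq 'X_{1..2}).
Implicit Types (p q m n : nat).

Definition spaced_point p q n i : 'X_{1..2} :=
  [multinom if j == ord0 then ((n - i) * p)%N else (i * q)%N | j < 2].

Definition spaced_points p q n : seq 'X_{1..2} := mkseq (spaced_point p q n) n.+1.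

Lemma spaced_point0 p q n i : spaced_point p q n i ord0 = ((n - i) * p)%N.
Proof. by rewrite mnmE. Qed.

Lemma spaced_point1 p q n i : spaced_point p q n i ord_max = (i * q)%N.
Proof. by rewrite mnmE. Qed.

Lemma mem_spaced_points p q n c :
  c \in spaced_points p q n <-> exists2 i, (i <= n)%N & c = spaced_point p q n i.
Proof.
split=> [/mapP[i]|[i i_n ->]]; first by rewrite mem_iota => /andP[_ i_n] ->; exists i.
by apply: map_f; rewrite mem_iota.
Qed.

Lemma sumset_spaced_points p q m n :
  sumset [set` spaced_points p q m] [set` spaced_points p q n] =
  [set` spaced_points p q (m + n)].
Proof.
have add i j : (i <= m)%N -> (j <= n)%N ->
    (spaced_point p q m i + spaced_point p q n j)%MM = spaced_point p q (m + n) (i + j).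
  move=> im jn; apply: mnm2P; rewrite mnmDE ?(spaced_point0, spaced_point1) -mulnDl //.
  by congr (_ * _)%N; lia.
apply/seteqP; split=> c /=.
  case=> _ [_ [/mem_spaced_points[i im ->] /mem_spaced_points[j jn ->] ->]].
  by rewrite add //; apply/mem_spaced_points; exists (i + j)%N => //; lia.
case/mem_spaced_points=> i imn ->.
(* The first summand takes as many of the [i] steps as it can. *)
exists (spaced_point p q m (minn i m)), (spaced_point p q n (i - m)).
split; try (apply/mem_spaced_points; eexists; last reflexivity); try lia.
by rewrite add; [congr spaced_point| |]; lia.
Qed.

Lemma nsumset_spaced_points p q n k :
  nsumset [set` spaced_points p q n] k = [set` spaced_points p q (k * n)].
Proof.
elim: k => [|k IHk]; last by rewrite mulSn -sumset_spaced_points -IHk.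
have zero : spaced_point p q 0 0 = 0%MM.
  by apply: mnm2P; rewrite ?(spaced_point0, spaced_point1) mnm0E.
apply/seteqP; split=> c /=; first by move=> ->; rewrite inE zero.
by rewrite inE zero => /eqP.
Qed.

Lemma spaced_points_min_gens p q n : (0 < p)%N -> (0 < q)%N ->
  is_min_gens (ideal_gen (@monomials K [set` spaced_points p q n]))
    (spaced_points p q n).
Proof.
move=> p0 q0; apply: antichain_min_gens.
  apply/(sortedP 0%MM) => i; rewrite size_mkseq => i_n.
  rewrite !nth_mkseq ?(ltnW i_n) // /lex_gt !spaced_point0 ltn_pmul2r //.
  by apply/orP; left; lia.
move=> _ _ /mem_spaced_points[i i_n ->] /mem_spaced_points[j j_n ->] /lem2P.
rewrite !(spaced_point0, spaced_point1) !leq_pmul2r // => ij.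
by congr spaced_point; lia.
Qed.

Lemma spaced_points_concave_pow p q n k : (0 < p)%N -> (0 < q)%N ->
  concave (ideal_pow (ideal_gen (@monomials K [set` spaced_points p q n])) k).
Proof.
move=> p0 q0; exists (spaced_points p q (k * n)).
rewrite ideal_pow_monomials nsumset_spaced_points.
split; first exact: spaced_points_min_gens.
move=> i; rewrite size_mkseq => ikn.
rewrite !nth_mkseq ?(ltnW ikn) ?(ltnW (ltnW ikn)) //; apply/lem2P.
rewrite !mulmnE !mnmDE !(spaced_point0, spaced_point1) -!mulnDl.
by rewrite ![(_ * _ * 2)%N]mulnAC !leq_mul //; lia.
Qed.

Lemma concave_no_corner_spaced I s : is_min_gens I s -> height_ge I 2 ->
  (forall i, (i.+2 < size s)%N ->
     (nth 0 s i + nth 0 s i.+2)%MM = (nth 0 s i.+1 *+ 2)%MM) ->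
  exists p q n, [/\ (0 < p)%N, (0 < q)%N & s = spaced_points p q n].
Proof.
move=> Is htI arith; have [s0 sy sx] := height2_ends Is htI.
have arith_coord (j : 'I_2) i : (i.+2 < size s)%N ->
    (nth 0%MM s i j + nth 0%MM s i.+2 j = (nth 0%MM s i.+1 j).*2)%N.
  by move=> /arith /(congr1 (fun c : 'X_{1..2} => c j)); rewrite mulmnE mnmDE muln2.
have stair i j := @min_gens_staircase K I s i j Is.
case size_s: (size s) s0 arith_coord stair sx => [//|n] _ arith_coord stair /= sx.
have yE i : (i <= n)%N -> (nth 0%MM s i ord_max = i * nth 0%MM s 1 ord_max)%N.
  apply: (@concave_seq_zero_second_difference n (fun i => nth 0%MM s i ord_max)) => //.
  by move=> l ln; apply: arith_coord.
have xE i : (i <= n)%N ->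
    (nth 0%MM s (n - i) ord0 = i * nth 0%MM s n.-1 ord0)%N.
  (* The first coordinates vanish at the last index, so they are read backwards. *)
  rewrite -subn1.
  apply: (@concave_seq_zero_second_difference n (fun i => nth 0%MM s (n - i) ord0)).
    move=> l ln; rewrite addnC.
    have -> : (n - l = (n - l.+2).+2)%N by lia.
    have -> : (n - l.+1 = (n - l.+2).+1)%N by lia.
    by apply: arith_coord; lia.
  by rewrite subn0.
case: (posnP n) => [n0|n_gt0].
  (* A single exponent vector is the origin, whatever the spacing. *)
  exists 1%N, 1%N, 0%N; split=> //; apply: (@eq_from_nth _ 0%MM).
    by rewrite size_mkseq size_s n0.
  rewrite size_s n0 => -[|//] _; rewrite n0 in sx; rewrite nth_mkseq //.
  by apply: mnm2P; rewrite ?(spaced_point0, spaced_point1) ?sx ?sy.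
exists (nth 0%MM s n.-1 ord0), (nth 0%MM s 1 ord_max), n; split.
- by have [|+ _] := stair n.-1 n; [lia|rewrite sx].
- by have [|_] := stair 0%N 1%N; [lia|rewrite sy].
apply: (@eq_from_nth _ 0%MM); first by rewrite size_mkseq.
move=> i; rewrite size_s => i_n; rewrite nth_mkseq //.
apply: mnm2P; rewrite ?(spaced_point0, spaced_point1) -?yE //.
by rewrite -xE ?leq_subr // subKn.
Qed.

End EquallySpaced.

(** * Powers of an ideal with an inner corner point *)

Section InnerCorner.
Variable K : fieldType.
Implicit Types (I : set {mpoly K[2]}) (s : seq 'X_{1..2}) (c d e : 'X_{1..2}).

(** The linear form that takes the same value at [(A, 0)] and [(0, B)]. *)
Definition weight A B c : nat := (c ord0 * B + c ord_max * A)%N.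

Lemma weightD A B c d : weight A B (c + d)%MM = (weight A B c + weight A B d)%N.
Proof. by rewrite /weight !mnmDE; lia. Qed.

Lemma weightMn A B c k : weight A B (c *+ k)%MM = (k * weight A B c)%N.
Proof. by rewrite /weight !mulmnE; lia. Qed.

Lemma weight_lem A B c d : (c <= d)%MM -> (weight A B c <= weight A B d)%N.
Proof. by case/lem2P=> c0 c1; rewrite /weight leq_add // leq_mul. Qed.

Lemma weight_lem_inj A B c d : (0 < A)%N -> (0 < B)%N -> (c <= d)%MM ->
  weight A B c = weight A B d -> c = d.
Proof.
move=> A0 B0 /lem2P[c0 c1]; rewrite /weight => cd.
have := leq_mul c0 (leqnn B); have := leq_mul c1 (leqnn A) => le1 le0.
have /eqP e0 : (c ord0 * B == d ord0 * B)%N by lia.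
have /eqP e1 : (c ord_max * A == d ord_max * A)%N by lia.
apply: mnm2P; apply/eqP; first by rewrite -(eqn_pmul2r B0) e0.
by rewrite -(eqn_pmul2r A0) e1.
Qed.

Lemma weight_concave A B s :
  (forall i, (i.+2 < size s)%N ->
     (nth 0 s i + nth 0 s i.+2 <= nth 0 s i.+1 *+ 2)%MM) ->
  concave_seq (size s).-1 (fun i => weight A B (nth 0%MM s i)).
Proof.
move=> sconc i i_s; have /sconc : (i.+2 < size s)%N by case: (size s) i_s.
by move/(weight_lem A B); rewrite weightMn weightD mul2n.
Qed.

(** The half plane on or above the line through [(k A, 0)] and [(0, k B)]; the
    second part keeps just enough of the fact that the points of interest on this
    line are sums of copies of [(A, 0)] and [(0, B)] to be stable under addition
    and under passing to larger exponents. *)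
Definition line_bound A B k c : Prop :=
  (k * (A * B) <= weight A B c)%N /\
  (weight A B c = k * (A * B) -> (k * A <= c ord0)%N \/ (B <= c ord_max)%N)%N.

Lemma line_bound_upper A B k c d : (0 < A)%N -> (0 < B)%N ->
  line_bound A B k c -> (c <= d)%MM -> line_bound A B k d.
Proof.
move=> A_gt0 B_gt0 [c_ge c_eq] cd; have cd_w := weight_lem A B cd.
split=> [|d_w]; first exact: leq_trans cd_w.
by rewrite -(weight_lem_inj A_gt0 B_gt0 cd) //; [apply: c_eq|]; lia.
Qed.

Lemma line_bound_nsumset A B (M : set 'X_{1..2}) k c :
  (forall d, M d -> line_bound A B 1 d) -> nsumset M k c -> line_bound A B k c.
Proof.
move=> MP; elim: k c => [|k IHk] c /=.
  by move=> ->; split=> [//|_]; left.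
case=> d [e [/MP[d_ge d_eq] /IHk[e_ge e_eq] ->]].
rewrite /line_bound weightD mulSn !mnmDE; split; first by lia.
move=> w; have {}d_eq := d_eq ltac:(lia); have {}e_eq := e_eq ltac:(lia).
by case: d_eq e_eq => [d0|d1] [e0|e1]; lia.
Qed.

(** The weights of the generators form a concave sequence with equal ends.  If
    one of its interior terms were on the line, the sequence would be constant,
    and the concavity inequality at the corner would be an equality. *)
Lemma inner_corner_line I s i : is_min_gens I s -> height_ge I 2 ->
  (forall j, (j.+2 < size s)%N ->
     (nth 0 s j + nth 0 s j.+2 <= nth 0 s j.+1 *+ 2)%MM) ->
  (i.+2 < size s)%N ->
  (nth 0 s i + nth 0 s i.+2 < nth 0 s i.+1 *+ 2)%MM ->
  let A := nth 0%MM s 0 ord0 in let B := nth 0%MM s (size s).-1 ord_max in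
  [/\ (0 < A)%N, (0 < B)%N & forall c, c \in s -> line_bound A B 1 c].
Proof.
move=> Is htI sconc i_s corner A B.
have [s0 sy sx] := height2_ends Is htI.
set n := (size s).-1 in sx B *.
have size_s : size s = n.+1 by rewrite prednK.
have [|ltA ltB] := @min_gens_staircase K I s 0 n Is; first by rewrite size_s; lia.
have A0 : (0 < A)%N by rewrite -sx.
have B0 : (0 < B)%N by rewrite -sy.
split=> // c /(nthP 0%MM)[j + <-]; rewrite size_s ltnS => j_n.
have w0 : weight A B (nth 0%MM s 0) = (A * B)%N by rewrite /weight sy mul0n addn0.
have wn : weight A B (nth 0%MM s n) = (A * B)%N by rewrite /weight sx mul0n mulnC.
have gconc := weight_concave A B sconc.
have gge := concave_seq_ge_ends gconc.
rewrite /= -/n w0 wn in gge; rewrite -/n in gconc.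
rewrite /line_bound !mul1n; split; first exact: gge.
have [->|j0] := posnP j; first by left.
have [->|/eqP jn] := eqVneq j n; first by right.
move=> wj; exfalso.
have flat l : (l <= n)%N -> weight A B (nth 0%MM s l) = (A * B)%N.
  rewrite -wj; apply: (concave_seq_interior_min gconc); first by lia.
  by move=> m mn /=; rewrite wj gge.
case/andP: corner => /eqP neq le; apply/neq/(weight_lem_inj A0 B0 le).
by rewrite weightMn weightD !flat; lia.
Qed.

(** The exponents of [I^k] on the line include [k c_0], [(k - 1) c_0 + c_n] and
    [k c_n].  Concavity would put all minimal generators of [I^k] on this line,
    but none of its points that come from [I^k] is below [(k - 1) c_0 + c_1]. *)
Lemma inner_corner_pow_not_concave I k : height_ge I 2 -> concave I ->
  (exists c, inner_corner_point I c) -> (2 <= k)%N -> ~ concave (ideal_pow I k).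
Proof.
move=> htI [s [Is sconc]] [_ [s' [i [Is' i_s _ corner]]]].
rewrite -(min_gens_unique Is Is') in i_s corner.
have [] := inner_corner_line Is htI sconc i_s corner.
have [s0 sy sx] := height2_ends Is htI.
set A := nth 0%MM s 0 ord0; set n := (size s).-1 in sx *.
set B := nth 0%MM s n ord_max => A0 B0 line1.
have size_s : size s = n.+1 by rewrite prednK.
case: k => // k k_gt0 [t [It tconc]].
set M := [set` s].
have IkE : ideal_pow I k.+1 = ideal_gen (@monomials K (nsumset M k.+1)).
  by rewrite -ideal_pow_monomials /M; case: (Is) => _ <- _.
have t_upper : upper [set` t] = upper (nsumset M k.+1).
  by apply/(@eq_ideal_gen_monomials K); rewrite -IkE; case: It.
have t_line c : c \in t -> line_bound A B k.+1 c.
  move=> tc; have [d Md dc] : upper (nsumset M k.+1) c.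
    by rewrite -t_upper; exists c => //; exact: lepm_refl.
  by apply: line_bound_upper dc => //; apply: line_bound_nsumset Md.
(* Nothing in [I^k] is below the line, and the weight is strictly monotone, so
   an exponent on the line is minimal. *)
have on_line c : nsumset M k.+1 c -> weight A B c = (k.+1 * (A * B))%N -> c \in t.
  move=> Mc wc; have [d /= td dc] : upper [set` t] c.
    by rewrite t_upper; exists c => //; exact: lepm_refl.
  rewrite -(weight_lem_inj A0 B0 dc) //; apply/eqP.
  by rewrite eqn_leq (weight_lem _ _ dc) wc; case: (t_line d td).
have Ms j : (j <= n)%N -> M (nth 0%MM s j) by move=> jn; apply: mem_nth; rewrite size_s.
have w0 : weight A B (nth 0%MM s 0) = (A * B)%N by rewrite /weight sy mul0n addn0.
have wn : weight A B (nth 0%MM s n) = (A * B)%N by rewrite /weight sx mul0n mulnC.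
have t_first := on_line _ (nsumset_mul k.+1 (Ms 0%N isT)).
have {t_first} := t_first ltac:(by rewrite weightMn w0).
move/(min_gens_first It); rewrite mulmnE sy => /(_ erefl) t_first.
have t_last := on_line _ (nsumset_mul k.+1 (Ms n (leqnn n))).
have {t_last} := t_last ltac:(by rewrite weightMn wn).
move/(min_gens_last It); rewrite mulmnE sx => /(_ erefl) t_last.
have /(nthP 0%MM)[j j_t tj] : (nth 0%MM s n + nth 0%MM s 0 *+ k)%MM \in t.
  apply: on_line; last by rewrite weightD weightMn w0 wn mulSn.
  exists (nth 0%MM s n), (nth 0%MM s 0 *+ k)%MM; split=> //; first exact: Ms.
  exact/nsumset_mul/Ms.
case size_t: (size t) j_t t_last => [//|m] /= j_t t_last.
have tj_x := congr1 (fun c : 'X_{1..2} => c ord0) tj.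
have tj_y := congr1 (fun c : 'X_{1..2} => c ord_max) tj.
rewrite !mnmDE !mulmnE sx sy -/A -/B mul0n add0n addn0 in tj_x tj_y.
have j_int : (0 < j < m)%N.
  have j0 : j <> 0%N by move=> j0; move: tj_y; rewrite j0 -t_first mulmnE sy; lia.
  have jN : j <> m.
    by move=> jN; move: tj_x; rewrite jN -t_last mulmnE sx mul0n; nia.
  lia.
have t_weight l : (l <= m)%N ->
    weight A B (nth 0%MM t l) = (k.+1 * (A * B))%N.
  have wj : weight A B (nth 0%MM t j) = (k.+1 * (A * B))%N.
    by rewrite tj weightD weightMn w0 wn mulSn.
  rewrite -wj; have := weight_concave A B tconc; rewrite size_t => gconc.
  apply: (concave_seq_interior_min gconc) => //.
  move=> l' lm; rewrite wj; have [|//] := t_line (nth 0%MM t l').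
  by apply: mem_nth; rewrite size_t.
have : upper [set` t] (nth 0%MM s 1 + nth 0%MM s 0 *+ k)%MM.
  rewrite t_upper; eexists; last exact: lepm_refl.
  exists (nth 0%MM s 1), (nth 0%MM s 0 *+ k)%MM; split=> //; last exact/nsumset_mul/Ms.
  by apply: Ms; lia.
case=> c /= tc /lem2P[]; rewrite !mnmDE !mulmnE sy -/A mul0n addn0 => c_x c_y.
have [|s1_x _] := @min_gens_staircase K I s 0 1 Is; first by rewrite size_s; lia.
have [|_ s1_y] := @min_gens_staircase K I s 1 n Is; first by rewrite size_s; lia.
rewrite -/A in s1_x; rewrite -/B in s1_y.
have [_ c_line] := t_line c tc.
have cw : weight A B c = (k.+1 * (A * B))%N.
  by have /(nthP 0%MM)[l + <-] := tc; rewrite size_t; apply: t_weight.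
by case: (c_line cw); rewrite ?mulSn; lia.
Qed.

End InnerCorner.

Theorem proposition2p5 (K : fieldType) (I : set {mpoly K[2]})
    (monoI : is_monomial_ideal I) (heightI : has_height I 2)
    (concI : concave I) :
  [<-> ~ (exists c, inner_corner_point I c);
       forall k : nat, (1 <= k)%N -> concave (ideal_pow I k);
       exists k : nat, (2 <= k)%N /\ concave (ideal_pow I k)]
  /\ ((exists c, inner_corner_point I c) ->
       forall k : nat, (2 <= k)%N -> ~ concave (ideal_pow I k)).
Proof.
case: heightI => htI _.
have corner_not_concave := inner_corner_pow_not_concave htI concI.
split; last by move=> corner k; apply: corner_not_concave.
tfae.
- move=> no_corner k _; have [s [Is sconc]] := concI.
  have arith i : (i.+2 < size s)%N ->
      (nth 0 s i + nth 0 s i.+2)%MM = (nth 0 s i.+1 *+ 2)%MM.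
    move=> i_s; apply/eqP/negPn/negP => neq; apply: no_corner.
    by exists (nth 0%MM s i.+1), s, i; split=> //; rewrite /ltm neq sconc.
  have [p [q [n [p0 q0 sE]]]] := concave_no_corner_spaced Is htI arith.
  by case: Is => _ -> _; rewrite sE; apply: spaced_points_concave_pow.
- by move=> conc; exists 2%N; split=> //; apply: conc.
- by case=> k [k2 conc] corner; apply: corner_not_concave conc.
Qed.
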